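(* (1) There is a nonempty perfect set $P\subseteq 2^\omega$ such that any two distinct elements of $P$ are not $\equiv_{e\infty}$-equivalent (i.e. there is a perfect set of infinite time eventual degrees). (2) If $E$ is an infinite time eventually enumerable equivalence relation on $2^\omega$, then equality on $2^\omega$ is Borel reducible to $E$: there is a Borel $f\colon2^\omega\to2^\omega$ such that $x=y\iff f(x)\mathrel{E}f(y)$ for all $x,y$.
   Context: Infinite time Turing machines: tapes of $\omega$ cells with values $0/1$ (input, work, output, optionally a parameter tape with a real), a finite program, successor steps as for ordinary Turing machines; at limit stages the head moves to the leftmost cell, the state becomes a special limit state, and each cell takes the $\limsup$ of its earlier values. A program eventually writes $y$ on input $x$ if from some ordinal stage on the output tape permanently shows $y$. $x\equiv_{e\infty}y$ iff there are programs (without parameter) that eventually write $y$ on input $x$ and eventually write $x$ on input $y$. A function $f$ is infinite time eventually computable if some program with some real parameter eventually writes $f(x)$ on each input $x$. An equivalence relation $E$ on $2^\omega$ with countable classes is infinite time eventually enumerable if there is an infinite time eventually computable $f$ such that $f(x)$ codes a sequence $\langle x_0,x_1,\dots\rangle$ with $\{x_n\}=[x]_E$ for all $x$. *)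

(* Defs.v *)
From mathcomp Require Import all_boot all_order.
From mathcomp Require Import all_classical.
From mathcomp Require Import wochoice topology cantor measure.
From Stdlib Require Import RelationClasses.

Set Implicit Arguments.
Unset Strict Implicit.
Unset Printing Implicit Defensive.

Local Open Scope classical_set_scope.

(** Ordinal stages *)

Record woType := WoType {
  wo_sort :> Type;
  wo_le : rel wo_sort;
  wo_leP : well_order wo_le }.

Section WoTheory.
Variable W : woType.
Implicit Types s t : W.

Definition wo_lt s t : bool := ~~ wo_le t s.

Definition wo_least t : Prop := forall s, wo_le t s.

Definition wo_covers s t : Prop := wo_lt s t /\ forall r, wo_lt r t -> wo_le r s.

Definition wo_limit t : Prop := ~ wo_least t /\ forall s, ~ wo_covers s t.

End WoTheory.

(** A point [b] of a well-order stands for the ordinal [{s | s < b}]; every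
    ordinal [beta] is obtained in this way, inside [beta + 1]. *)
Record stage := Stage { stage_wo : woType; stage_pt : stage_wo }.

(** Comparison of ordinals: [a <= b] iff there is a strictly increasing map from
    the strict initial segment below [a] to the one below [b]. *)
Definition stage_le (a b : stage) : Prop :=
  exists h : stage_wo a -> stage_wo b,
    (forall s, wo_lt s (stage_pt a) -> wo_lt (h s) (stage_pt b)) /\
    (forall s t, wo_lt s t -> wo_lt t (stage_pt a) -> wo_lt (h s) (h t)).

(** Infinite time Turing machines *)

(** A program for a machine with [k] parameter tapes, hence [k.+3] tapes: number
    0 is the input tape, 1 the work tape, 2 the output tape, and the following
    ones are the parameter tapes (only [k = 0] and [k = 1] are used).  A single
    head reads the cells of all the tapes at the same position.  The states are
    the elements of ['I_n.+3], among which 0 is the start state, 1 the limit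
    state and 2 the halting state.  The transition table maps a state and the
    symbols read to a new state, the symbols to be written, and a direction
    ([true] is right, [false] is left). *)
Record program (k : nat) := Program {
  nstates : nat;
  delta : {ffun 'I_nstates.+3 * {ffun 'I_k.+3 -> bool} ->
                'I_nstates.+3 * {ffun 'I_k.+3 -> bool} * bool} }.

Section Machine.
Variables (k : nat) (p : program k).

Definition state := 'I_(nstates p).+3.

Definition start_state : state := @Ordinal (nstates p).+3 0 isT.
Definition limit_state : state := @Ordinal (nstates p).+3 1 isT.
Definition halt_state : state := @Ordinal (nstates p).+3 2 isT.

Record config := Config {
  cstate : state;
  chead : nat;
  ctape : 'I_k.+3 -> nat -> bool }.

Definition halted (c : config) : bool := cstate c == halt_state.

Definition init_config (tapes : 'I_k.+3 -> nat -> bool) : config :=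
  Config start_state 0 tapes.

(** The head stays in place when told to move left of cell 0. *)
Definition step (c : config) : config :=
  if halted c then c else
  let: (q, w, dir) := delta p (cstate c, [ffun i => ctape c i (chead c)]) in
  Config q (if dir then (chead c).+1 else (chead c).-1)
    (fun i j => if j == chead c then w i else ctape c i j).

(** The value of a cell is [inf_(s < t) sup_(s <= r < t)] of its earlier
    values. *)
Definition limit_config (W : woType) (c : W -> config) (t : W) : config :=
  Config limit_state 0 (fun i j =>
    `[< forall s, wo_lt s t ->
          exists r, [/\ wo_le s r, wo_lt r t & ctape (c r) i j] >]).

(** A configuration which has halted is kept at all later stages, including the
    limit ones. *)
Record is_computation (tapes : 'I_k.+3 -> nat -> bool) (W : woType)
    (c : W -> config) : Prop := IsComputation {
  computation_zero : forall t, wo_least t -> c t = init_config tapes;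
  computation_succ : forall s t, wo_covers s t -> c t = step (c s);
  computation_limit : forall t, wo_limit t ->
    (forall s, wo_lt s t -> ~~ halted (c s)) -> c t = limit_config c t;
  computation_halted : forall s t, wo_lt s t -> halted (c s) -> c t = c s }.

Definition output_tape : 'I_k.+3 := @Ordinal k.+3 2 isT.

Definition shows_at (tapes : 'I_k.+3 -> nat -> bool) (b : stage)
    (y : cantor_space) : Prop :=
  exists2 c : stage_wo b -> config,
    is_computation tapes c & ctape (c (stage_pt b)) output_tape = y.

End Machine.

Definition blank : cantor_space := fun=> false.

Definition initial_tapes (z : seq cantor_space) (x : cantor_space)
    (i : 'I_(size z).+3) : nat -> bool :=
  nth blank [:: x, blank, blank & z] i.

Definition eventually_writes (z : seq cantor_space) (p : program (size z))
    (x y : cantor_space) : Prop :=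
  exists a : stage, forall b : stage, stage_le a b ->
    shows_at p (initial_tapes x) b y.

Definition ev_equiv (x y : cantor_space) : Prop :=
  (exists p : program 0, @eventually_writes [::] p x y) /\
  (exists q : program 0, @eventually_writes [::] q y x).

Definition ev_computable (f : cantor_space -> cantor_space) : Prop :=
  exists (z : cantor_space) (p : program 1),
    forall x, @eventually_writes [:: z] p x (f x).

(** [(n, m) |-> 2 ^ n * (2 * m + 1) - 1] is a bijection from [nat * nat] to
    [nat]. *)
Definition coded_seq (y : cantor_space) (n : nat) : cantor_space :=
  fun m => y (2 ^ n * m.*2.+1).-1.

Definition ev_enumerable (E : cantor_space -> cantor_space -> Prop) : Prop :=
  [/\ Equivalence E,
      forall x, countable [set y | E x y] &
      exists2 f, ev_computable f &
        forall x, range (coded_seq (f x)) = [set y | E x y]].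

(** Borel reducibility *)

Definition borel_cantor := g_sigma_algebraType (@open cantor_space).

Definition borel_reducible (E F : cantor_space -> cantor_space -> Prop) : Prop :=
  exists2 f : borel_cantor -> borel_cantor,
    measurable_fun setT f & forall x y, E x y <-> F (f x) (f y).

(* Main.v *)
(* For a program p (with parameters) the configurations at a countable stage
   depend on the input in a Baire measurable way, so by the countable chain
   condition modulo meager sets there are countable limit stages alpha < beta
   such that, for comeagerly many inputs x, the run on x has the same
   configuration at alpha and beta, and every cell showing 1 in between shows 1
   at alpha.  Such a run repeats the segment [alpha, beta) forever, so if it
   eventually writes y, then y is the output at stage alpha.  Hence on a
   comeager set every eventually writable function agrees with a Baire
   measurable one.  Given countably many such functions h_n, a fusion argument
   in the style of Mycielski yields a perfect set of points of the comeager set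
   no point of which is the image under some h_n of another one. *)
Require Import Defs.
From mathcomp Require Import all_boot all_order.
From mathcomp Require Import all_classical.
From mathcomp Require Import wochoice topology cantor measure.
From Stdlib Require Import RelationClasses.

Set Implicit Arguments.
Unset Strict Implicit.
Unset Printing Implicit Defensive.

Local Open Scope classical_set_scope.

(** * Baire category by finite strings *)

Section Category.
Implicit Types (s t u : seq bool) (A B : set cantor_space) (x : cantor_space).

Definition cyl s : set cantor_space := [set x | mkseq x (size s) = s].

(* Each [D n] is a dense set of strings; the strings which have a prefix in it
   make up a dense open set. *)
Definition comeager A : Prop :=
  exists D : nat -> set (seq bool),
    (forall n s, exists t, D n (s ++ t)) /\
    (forall x, (forall n, exists k, D n (mkseq x k)) -> A x).

(** Cohen forcing with finite strings: [A] is comeager inside the cylinder of [s]. *)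
Definition forces s A : Prop := comeager [set x | cyl s x -> A x].

(** Density form of the Baire property: up to a meager set, [A] is the open union of the cylinders
    that force it. *)
Definition baire_property A : Prop :=
  forall s, exists t, forces (s ++ t) A \/ forces (s ++ t) (~` A).

Lemma cyl_mkseq x k : cyl (mkseq x k) x.
Proof. by rewrite /cyl /= size_mkseq. Qed.

Lemma cyl_mkseqE x y k : cyl (mkseq x k) y <-> mkseq y k = mkseq x k.
Proof. by rewrite /cyl /= size_mkseq. Qed.

Lemma take_mkseq (T : Type) (f : nat -> T) m n :
  m <= n -> take m (mkseq f n) = mkseq f m.
Proof. by move=> le; rewrite -map_take take_iota (minn_idPl le). Qed.

Lemma cyl_nth s x i : cyl s x -> i < size s -> nth false s i = x i.
Proof. by move=> <-; rewrite size_mkseq => lti; rewrite nth_mkseq. Qed.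

Lemma cylP s x : (forall i, i < size s -> nth false s i = x i) -> cyl s x.
Proof.
move=> sx; apply: (@eq_from_nth _ false); rewrite size_mkseq // => i lti.
by rewrite nth_mkseq // sx.
Qed.

Lemma cyl_cat s t x : cyl (s ++ t) x -> cyl s x.
Proof.
move=> stx; apply: cylP => i lti; rewrite -(cyl_nth stx) ?nth_cat ?lti //.
by rewrite size_cat ltn_addr.
Qed.

Lemma cyl_prefix s t x : cyl s x -> cyl t x -> size s <= size t ->
  t = s ++ drop (size s) t.
Proof.
move=> sx tx le; rewrite -{1}(cat_take_drop (size s) t); congr (_ ++ _).
apply: (@eq_from_nth _ false); rewrite size_takel // => i lti.
by rewrite nth_take // (cyl_nth sx) // (cyl_nth tx) // (leq_trans lti).
Qed.

Lemma comeager_sub A B : A `<=` B -> comeager A -> comeager B.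
Proof. by move=> AB [D [Dd DA]]; exists D; split=> // x /DA/AB. Qed.

Lemma comeagerT : comeager setT.
Proof. by exists (fun=> setT); split=> // n s; exists [::]. Qed.

Lemma comeager_capN (A : nat -> set cantor_space) :
  (forall n, comeager (A n)) -> comeager [set x | forall n, A n x].
Proof.
move=> /choice[D DA].
exists (fun m => if unpickle m is Some (n, k) then D n k else setT); split.
  move=> m s; case: (unpickle m) => [[n k]|]; last by exists [::].
  exact: (DA n).1.
move=> x Dx n; apply: (DA n).2 => k.
by have := Dx (pickle (n, k)); rewrite pickleK.
Qed.

Lemma comeager_cap (I : Type) (D : set I) (A : I -> set cantor_space) :
  countable D -> (forall i, D i -> comeager (A i)) ->
  comeager [set x | forall i, D i -> A i x].
Proof.
move=> /countable_injP[f finj] DA.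
suff: comeager [set x | forall n i, D i -> f i = n -> A i x].
  by apply: comeager_sub => x Ax i Di; exact: Ax (f i) i Di erefl.
apply: comeager_capN => n.
have [[i [Di fi]]|nex] := pselect (exists i, D i /\ f i = n); last first.
  by apply: comeager_sub comeagerT => x _ i Di fi; case: nex; exists i.
apply: comeager_sub (DA i Di) => x Aix j Dj fj.
by rewrite (_ : j = i) //; apply: finj; rewrite ?inE // fi.
Qed.

Lemma comeager_capC (I : countType) (A : I -> set cantor_space) :
  (forall i, comeager (A i)) -> comeager [set x | forall i, A i x].
Proof.
move=> AI; have := @comeager_cap I setT A (countableP _) (fun i _ => AI i).
by apply: comeager_sub => x Ax i; apply: Ax.
Qed.

Lemma comeagerI A B : comeager A -> comeager B -> comeager (A `&` B).
Proof.
move=> cA cB; have: comeager [set x | forall b : bool, (if b then A else B) x].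
  by apply: comeager_capC => -[].
by apply: comeager_sub => x AB; split; [exact: (AB true)|exact: (AB false)].
Qed.

Lemma forces_sub s A B : A `<=` B -> forces s A -> forces s B.
Proof. by move=> AB; apply: comeager_sub => x sA /sA/AB. Qed.

Lemma forces_cat s t A : forces s A -> forces (s ++ t) A.
Proof. by apply: comeager_sub => x sA /cyl_cat/sA. Qed.

(** Forced statements are true at generic points: there are countably many strings, so one comeager
    set serves them all. *)
Lemma comeager_forced A :
  comeager [set x | forall s, forces s A -> cyl s x -> A x].
Proof.
apply: comeager_capC => s.
have [sA|nsA] := pselect (forces s A).
  by apply: comeager_sub sA => x Ax _.
exact: comeager_sub comeagerT.
Qed.

(** A locally comeager set is comeager: a generic point passes through a string forcing [A], and
    [comeager_forced] applies there. *)
Lemma comeager_dense A : (forall s, exists t, forces (s ++ t) A) -> comeager A.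
Proof.
move=> dA; have : comeager [set x | exists k, forces (mkseq x k) A].
  by exists (fun=> [set s | forces s A]); split => // x /(_ 0).
move=> /comeagerI/(_ (comeager_forced A)); apply: comeager_sub => x [[k kA] Ax].
exact: Ax kA (@cyl_mkseq _ _).
Qed.

Lemma forces_dense s A : (forall t, exists u, forces ((s ++ t) ++ u) A) ->
  forces s A.
Proof.
move=> dA; apply: comeager_dense => t.
(* If [t] and [s] are compatible, density below [s] applies to a common extension; otherwise their
   cylinders are disjoint and the implication is vacuous on that of [t]. *)
have [[u [v uv]]|ncompat] := pselect (exists u v, t ++ u = s ++ v).
  have [w sw] := dA v; exists (u ++ w).
  by rewrite catA uv; apply: forces_sub sw => x Ax _.
exists [::]; rewrite cats0; apply: comeager_sub comeagerT => x _ tx sx.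
case: ncompat; case: (leqP (size s) (size t)) => [le|/ltnW le].
  by exists [::], (drop (size s) t); rewrite cats0; exact: cyl_prefix sx tx le.
by exists (drop (size t) s), [::]; rewrite cats0 -(cyl_prefix tx sx le).
Qed.

Lemma baire_property_forces A s : baire_property A ->
  ~ forces s (~` A) -> exists t, forces (s ++ t) A.
Proof.
move=> bA nA; apply: contrapT => nex; apply: nA; apply: forces_dense => t.
have [u [uA|uA]] := bA (s ++ t); last by exists u.
by case: nex; exists (t ++ u); rewrite catA.
Qed.

Lemma baire_propertyC A : baire_property A -> baire_property (~` A).
Proof.
by move=> bA s; have [t [tA|tA]] := bA s; exists t; [right|left];
  rewrite ?setCK.
Qed.

(** Either an extension of [s] forces some [A i], or [s] forces every complement and hence, by
    countability, their intersection. *)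
Lemma baire_property_bigcup (I : Type) (D : set I) (A : I -> set cantor_space) :
  countable D -> (forall i, D i -> baire_property (A i)) ->
  baire_property (\bigcup_(i in D) A i).
Proof.
move=> cD bA s.
have [[i [Di [t tA]]]|nex] :=
    pselect (exists i, D i /\ exists t, forces (s ++ t) (A i)).
  by exists t; left; apply: forces_sub tA => x; exists i.
exists [::]; right; rewrite cats0.
have: comeager [set x | forall i, D i -> cyl s x -> ~ A i x].
  apply: comeager_cap => // i Di; apply: contrapT => nA; apply: nex.
  by exists i; split=> //; apply: baire_property_forces => //; exact: bA.
by apply: comeager_sub => x Ax sx [i Di Aix]; exact: Ax Di sx Aix.
Qed.

Lemma baire_property_bigcap (I : Type) (D : set I) (A : I -> set cantor_space) :
  countable D -> (forall i, D i -> baire_property (A i)) ->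
  baire_property (\bigcap_(i in D) A i).
Proof.
move=> cD bA; rewrite -[X in baire_property X]setCK setC_bigcap.
apply/baire_propertyC/baire_property_bigcup => // i Di.
exact/baire_propertyC/bA.
Qed.

Lemma baire_propertyI A B : baire_property A -> baire_property B ->
  baire_property (A `&` B).
Proof.
move=> bA bB; rewrite -bigcap2E.
by apply: baire_property_bigcap => // -[|[|n]] _ //= s; exists [::]; left;
  apply: comeager_sub comeagerT.
Qed.

Lemma baire_propertyU A B : baire_property A -> baire_property B ->
  baire_property (A `|` B).
Proof.
move=> bA bB; rewrite -[X in baire_property X]setCK setCU.
by apply/baire_propertyC/baire_propertyI; exact/baire_propertyC.
Qed.

Lemma baire_property_cst (P : Prop) : baire_property [set _ | P].
Proof.
by move=> s; exists [::]; have [p|np] := pselect P; [left|right];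
  apply: comeager_sub comeagerT => x _ _.
Qed.

Lemma baire_property_coord i : baire_property [set x : cantor_space | x i].
Proof.
(* Padding by [i.+1] bits makes the string longer than [i], whatever [s] is, so it decides the
   coordinate. *)
move=> s; exists (nseq i.+1 false).
have lti : i < size (s ++ nseq i.+1 false).
  by rewrite size_cat size_nseq; apply: ltn_addl.
have [si|nsi] := boolP (nth false (s ++ nseq i.+1 false) i); [left|right];
  apply: comeager_sub comeagerT => x _ /= /cyl_nth/(_ lti) <- //.
exact/negP.
Qed.

End Category.

(** * Perfect sets avoiding countably many functions *)

Section Mycielski.
Implicit Types (tau : seq bool -> seq bool) (s t : seq bool).

Definition extends tau tau' := forall s, exists v, tau' s = tau s ++ v.

Lemma extends_refl tau : extends tau tau.
Proof. by move=> s; exists [::]; rewrite cats0. Qed.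

Lemma extends_trans tau1 tau2 tau3 :
  extends tau1 tau2 -> extends tau2 tau3 -> extends tau1 tau3.
Proof.
move=> e12 e23 s; have [v ev] := e12 s; have [w ew] := e23 s.
by exists (v ++ w); rewrite ew ev catA.
Qed.

(* The conditions of the fusion argument are assignments of strings to the nodes
   of the binary tree. *)
Definition dense_open (Q : (seq bool -> seq bool) -> Prop) :=
  (forall tau, exists tau', extends tau tau' /\ Q tau') /\
  (forall tau tau', extends tau tau' -> Q tau -> Q tau').

Lemma dense_open_and Q Q' :
  dense_open Q -> dense_open Q' -> dense_open (fun tau => Q tau /\ Q' tau).
Proof.
move=> [dQ oQ] [dQ' oQ']; split=> [tau|tau tau' e [Qt Qt']]; last first.
  by split; [exact: oQ e Qt|exact: oQ' e Qt'].
have [tau1 [e1 Q1]] := dQ tau; have [tau2 [e2 Q2]] := dQ' tau1.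
exists tau2; split; first exact: extends_trans e1 e2.
by split=> //; exact: oQ e2 Q1.
Qed.

Lemma dense_open_imply (P : Prop) Q :
  (P -> dense_open Q) -> dense_open (fun tau => P -> Q tau).
Proof.
move=> dQ; have [/dQ{}dQ|nP] := pselect P.
  split=> [tau|tau tau' e Qt p]; last exact: dQ.2 e (Qt p).
  by have [tau' [e Q']] := dQ.1 tau; exists tau'.
by split=> // tau; exists tau; split => //; exact: extends_refl.
Qed.

Lemma dense_open_fin (I : finType) (Q : I -> (seq bool -> seq bool) -> Prop) :
  (forall i, dense_open (Q i)) -> dense_open (fun tau => forall i, Q i tau).
Proof.
move=> dQ; have: dense_open (fun tau => forall i, i \in enum I -> Q i tau).
  elim: (enum I) => [|j r IH].
    by split=> // tau; exists tau; split => //; exact: extends_refl.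
  have [dj oj] := dense_open_and (dQ j) IH; split=> [tau|tau tau' e Qt].
    have [tau' [e [Qj Qr]]] := dj tau; exists tau'; split=> // i.
    by rewrite inE => /predU1P[->|/Qr].
  by move=> i /Qt; exact: (dQ i).2 e.
move=> [d o]; split=> [tau|tau tau' e Qt i]; last exact: (dQ i).2 e (Qt i).
by have [tau' [e Q']] := d tau; exists tau'; split=> // i; apply: Q';
  rewrite mem_enum.
Qed.

Lemma dense_open_meet s (D : set (seq bool)) :
  (forall u, exists v, D (u ++ v)) ->
  dense_open (fun tau => exists v w, tau s = v ++ w /\ D v).
Proof.
move=> dD; split=> [tau|tau tau' e [v [w [vw Dv]]]].
  have [v Dv] := dD (tau s).
  exists (fun t => if t == s then tau s ++ v else tau t); split=> [t|].
    case: eqP => [->|_]; first by exists v.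
    by exists [::]; rewrite cats0.
  by exists (tau s ++ v), [::]; rewrite eqxx cats0.
by have [z ez] := e s; exists v, (w ++ z); rewrite ez vw catA.
Qed.

(** Extend [tau s] to decide the bit of [h x] at position [size (tau t)], then append the opposite
    bit to [tau t]; as [s <> t], the two changes do not interfere. No generic point through [tau s]
    is then sent by [h] to a point through [tau t]. *)
Lemma dense_open_separate (h : cantor_space -> cantor_space) s t :
  (forall m, baire_property [set x | h x m]) -> s <> t ->
  dense_open (fun tau => exists m b, [/\ m < size (tau t),
    nth false (tau t) m = ~~ b & forces (tau s) [set x | h x m = b]]).
Proof.
move=> bh st; split=> [tau|tau tau' e [m [b [ltm mb f]]]]; last first.
  have [v ev] := e t; have [w ew] := e s; exists m, b; split.
  - by rewrite ev size_cat ltn_addr.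
  - by rewrite ev nth_cat ltm.
  - by rewrite ew; exact: forces_cat.
have [v [b fb]] : exists v b,
  forces (tau s ++ v) [set x | h x (size (tau t)) = b].
  have [v [fv|fv]] := bh (size (tau t)) (tau s); exists v.
    by exists true.
  by exists false; apply: forces_sub fv => x /negP/negbTE.
exists (fun u => if u == s then tau s ++ v else
  if u == t then rcons (tau t) (~~ b) else tau u); split=> [u|].
  case: eqP => [->|_]; first by exists v.
  case: eqP => [->|_]; first by exists [:: ~~ b]; rewrite cats1.
  by exists [::]; rewrite cats0.
have ts : (t == s) = false by apply/eqP => ts; exact: st.
exists (size (tau t)), b; rewrite !eqxx ts size_rcons; split=> //.
by rewrite nth_rcons ltnn eqxx.
Qed.

Lemma mycielski (h : nat -> cantor_space -> cantor_space)
    (C : set cantor_space) :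
  (forall n m, baire_property [set x | h n x m]) -> comeager C ->
  exists phi : cantor_space -> cantor_space,
    [/\ forall (u v : cantor_space) m,
          mkseq u m.+1 = mkseq v m.+1 -> phi u m = phi v m,
        forall u, C (phi u) &
        forall u v, u <> v -> forall n, h n (phi u) <> phi v].
Proof.
move=> bh cC.
(* Points of [G] obey every forced bit of every [h n], so separations forced during the construction
   come true. *)
pose G := C `&` [set x | forall (i : nat * nat * bool) s,
  forces s [set x | h i.1.1 x i.1.2 = i.2] -> cyl s x -> h i.1.1 x i.1.2 = i.2].
have [D [dD DG]] : comeager G.
  by apply: comeagerI cC _; apply: comeager_capC => i; exact: comeager_forced.
(* Requirements of level [l]: nodes of length [l] enter the first [l] dense sets, and distinct nodes
   are separated for the first [l] functions. *)
pose Q l tau := forall i : 'I_l * l.-tuple bool * l.-tuple bool,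
  (exists v w, tau i.1.2 = v ++ w /\ D i.1.1 v) /\
  (i.1.2 <> i.2 :> seq bool -> exists m b, [/\ m < size (tau i.2),
    nth false (tau i.2) m = ~~ b &
    forces (tau i.1.2) [set x | h i.1.1 x m = b]]).
have dQ l : dense_open (Q l).
  apply: dense_open_fin => i; apply: dense_open_and.
    exact: (dense_open_meet i.1.2 (dD i.1.1)).
  apply: dense_open_imply => ?; apply: dense_open_separate => //.
(* A node starts from the string of its parent followed by its own last bit, so strings grow by at
   least one bit per level. *)
pose ext1 l tau s := rcons (tau (take l s)) (nth false s l).
have /choice[F FQ] : forall i : nat * (seq bool -> seq bool),
    exists tau, extends (ext1 i.1 i.2) tau /\ Q i.1.+1 tau.
  by move=> i; exact: (dQ _).1.
pose fix T l := if l is k.+1 then F (k, T k) else fun=> [::].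
have TQ l : Q l.+1 (T l.+1) by exact: (FQ (l, T l)).2.
have TS l (u : cantor_space) : exists v,
    T l.+1 (mkseq u l.+1) = rcons (T l (mkseq u l)) (u l) ++ v.
  have [v ev] := (FQ (l, T l)).1 (mkseq u l.+1); exists v; apply: etrans ev _.
  by rewrite /ext1 /= take_mkseq // nth_mkseq.
have Tle l k (u : cantor_space) : l <= k -> exists v,
    T k (mkseq u k) = T l (mkseq u l) ++ v.
  move=> /subnKC <-; elim: (k - l) => [|j [v ev]].
    by exists [::]; rewrite addn0 cats0.
  have [w ew] := TS (l + j) u.
  by rewrite addnS ew ev; exists (rcons v (u (l + j)) ++ w);
    rewrite rcons_cat catA.
have Tsz l (u : cantor_space) : l <= size (T l (mkseq u l)).
  elim: l => // l IH; have [v ->] := TS l u.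
  by rewrite size_cat size_rcons (leq_trans _ (leq_addr _ _)).
(* By [Tsz] the string at level [m.+1] has more than [m] bits, so the default [false] is never
   read. *)
pose phi (u : cantor_space) : cantor_space :=
  fun m => nth false (T m.+1 (mkseq u m.+1)) m.
have phiT l u : cyl (T l (mkseq u l)) (phi u).
  apply: cylP => i lti; rewrite /phi; have [le|/ltnW le] := leqP l i.+1.
    by have [v ->] := Tle _ _ u le; rewrite nth_cat lti.
  by have [v ->] := Tle _ _ u le; rewrite nth_cat (leq_trans _ (Tsz i.+1 u)).
have tup l (u : cantor_space) : size (mkseq u l) == l by rewrite size_mkseq.
have phiG u : G (phi u).
  apply: DG => n.
  have [[v [w [ev Dv]]] _] :=
    TQ n (ord_max, Tuple (tup n.+1 u), Tuple (tup n.+1 u)).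
  exists (size v); have := phiT n.+1 u.
  by move: ev => /= -> /cyl_cat ->.
exists phi; split=> [u v m uv|u|u v uv n huv]; first by rewrite /phi uv.
  by have [] := phiG u.
have [i ui] : exists i, u i <> v i.
  apply: contrapT => nex; apply: uv; apply: funext => i.
  by apply: contrapT => ui; apply: nex; exists i.
(* Level [l.+1] treats [h n] and is deep enough for [u] and [v] to pass through distinct nodes. *)
pose l := maxn n i.
have ln : n < l.+1 by rewrite ltnS leq_maxl.
have [_ /(_ _)[|m [b [/= ltm mb fb]]]] :=
    TQ l (Ordinal ln, Tuple (tup l.+1 u), Tuple (tup l.+1 v)).
  move=> /= /(congr1 (nth false ^~ i)).
  by rewrite !nth_mkseq ?ltnS ?leq_maxr.
have /= hb := (phiG u).2 (n, m, b) _ fb (phiT l.+1 u).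
have := cyl_nth (phiT l.+1 v) ltm.
by rewrite mb -huv hb; case: (b).
Qed.

End Mycielski.

(** * Cylinders and the topology of Cantor space *)

Lemma nbhs_cyl (x : cantor_space) (U : set cantor_space) :
  nbhs x U -> exists k, cyl (mkseq x k) `<=` U.
Proof.
pose F : set_system cantor_space := filter_from setT (fun k => cyl (mkseq x k)).
have FF : Filter F.
  apply: filter_from_filter; first by exists 0.
  move=> i j _ _; exists (maxn i j) => // y /cyl_mkseqE xy.
  have take_eq k : k <= maxn i j -> mkseq y k = mkseq x k.
    by move=> le; rewrite -[LHS](take_mkseq _ le) -[RHS](take_mkseq _ le) xy.
  by split; apply/cyl_mkseqE/take_eq; rewrite ?leq_maxl ?leq_maxr.
(* The product topology is the supremum of the topologies induced by the coordinates, so convergence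
   is checked on each coordinate. *)
have Fx : F --> x.
  apply/cvg_sup => i; apply/cvg_image.
    rewrite eqEsubset; split=> // b _; exists (fun=> b : bool) => //.
  move=> A /nbhs_singleton Axi; exists ((fun y : cantor_space => y i) @^-1` A).
    exists i.+1 => // y /cyl_mkseqE /(congr1 (nth false ^~ i)).
    rewrite !nth_mkseq //= => ->; exact: Axi.
  rewrite eqEsubset; split=> [b [y Ay <-] //|b Ab].
  by exists (fun=> b : bool).
by move=> /Fx[k _ kU]; exists k.
Qed.

Lemma cyl_nbhs (x : cantor_space) k : nbhs x (cyl (mkseq x k)).
Proof.
have: nbhs x [set y : cantor_space | forall i, i < k -> y i = x i].
  elim: k => [|k IH]; first by apply: filterS filterT => y _ i.
  have nk : nbhs x [set y : cantor_space | y k = x k].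
    apply: (@proj_continuous nat (fun=> bool) k x [set b | b = x k]).
    exact: discrete_set1.
  apply: filterS (filterI IH nk).
  move=> y [yx ykx] i; rewrite ltnS leq_eqVlt => /predU1P[->|/yx]//.
apply: filterS => y yx; apply/cyl_mkseqE.
by apply: (@eq_from_nth _ false); rewrite !size_mkseq // => i ik;
  rewrite !nth_mkseq // yx.
Qed.

Lemma finitary_continuous (phi : cantor_space -> cantor_space) :
  (forall (u v : cantor_space) m,
    mkseq u m.+1 = mkseq v m.+1 -> phi u m = phi v m) -> continuous phi.
Proof.
move=> fphi u U /nbhs_cyl[k kU];
  apply: filterS (cyl_nbhs u k) => v /cyl_mkseqE vu.
apply/kU/cyl_mkseqE; apply: (@eq_from_nth _ false);
  rewrite !size_mkseq // => i ik.
by rewrite !nth_mkseq //; apply: fphi; rewrite -!(take_mkseq _ ik) vu.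
Qed.

Lemma perfect_range (phi : cantor_space -> cantor_space) :
  continuous phi -> injective phi -> perfect_set (range phi).
Proof.
move=> cphi iphi.
have clP : closed (range phi).
  apply: compact_closed; first exact: cantor_space_hausdorff.
  by apply: continuous_compact cantor_space_compact;
    exact: continuous_subspaceT.
split=> //; rewrite eqEsubset; split.
  by rewrite [X in _ `<=` X](closure_id _).1 //; exact: subset_limit_point.
move=> _ [u _ <-] U /cphi/nbhs_cyl[k kU].
(* Flipping bit [k] stays inside the cylinder of length [k] and, by injectivity, changes the
   image. *)
pose v : cantor_space := fun i => if i == k then ~~ u k else u i.
exists (phi v); split; last 1 first.
- apply/kU/cyl_mkseqE.
  apply: (@eq_from_nth _ false); rewrite !size_mkseq // => i ik.
  by rewrite !nth_mkseq // /v ltn_eqF.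
- apply/eqP => /iphi/(congr1 (fun w : cantor_space => w k)).
  by rewrite /v eqxx; case: (u k).
- by exists v.
Qed.

Lemma continuous_borel (phi : cantor_space -> cantor_space) :
  continuous phi -> measurable_fun setT (phi : borel_cantor -> borel_cantor).
Proof.
move=> /continuousP cphi;
  apply: (@measurability _ _ borel_cantor borel_cantor _ _
    (@open cantor_space)) => //.
move=> _ [A oA <-]; rewrite setTI; apply: sub_sigma_algebra; exact: cphi.
Qed.

(** * Computations along a well-order *)

Section WellOrder.
Variable W : woType.
Implicit Types (r s t : W) (P : set W).

(** [well_order] provides a unique minimum for each nonempty boolean predicate; the order axioms
    below are read off from minima of sets of two or three points. *)
Lemma wo_min P : P !=set0 -> exists t, P t /\ forall s, P s -> wo_le t s.
Proof.
move=> [s Ps]; have [|t [[tP tmin] _]] := @wo_leP W [pred x | `[< P x >]].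
  by exists s; rewrite inE.
exists t; split; first by move: tP; rewrite inE.
by move=> r Pr; apply: tmin; rewrite inE.
Qed.

Lemma wo_total s t : wo_le s t || wo_le t s.
Proof.
have [|r [[->|->] rmin]] := @wo_min [set r | r = s \/ r = t].
- by exists s; left.
- by rewrite (rmin t) //; right.
- by rewrite (rmin s) ?orbT //; left.
Qed.

Lemma wo_refl t : wo_le t t.
Proof. by have := wo_total t t; rewrite orbb. Qed.

Lemma wo_anti s t : wo_le s t -> wo_le t s -> s = t.
Proof.
move=> st ts; pose A := [pred x : W | `[< x = s \/ x = t >]].
have minA x : x = s \/ x = t -> minimum_of (@wo_le W) A x.
  move=> xst; split; first by rewrite inE.
  by move=> y; rewrite inE; case: xst => -> [] ->; rewrite ?wo_refl.
have [|r [_ runiq]] := @wo_leP W A; first by exists s; rewrite inE; left.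
by rewrite -(runiq s) ?(runiq t) //; apply: minA; [right|left].
Qed.

Lemma wo_trans r s t : wo_le r s -> wo_le s t -> wo_le r t.
Proof.
move=> rs st.
have [|x [xP xmin]] := @wo_min [set x | [\/ x = r, x = s | x = t]].
  by exists r; constructor 1.
case: xP => ex; subst x.
- by apply: xmin; constructor 3.
- by rewrite (wo_anti rs (xmin r _)) //; constructor 1.
- have ts : wo_le t s by apply: xmin; constructor 2.
  by rewrite -(wo_anti st ts).
Qed.

Lemma wo_ltNge s t : wo_lt s t = ~~ wo_le t s. Proof. by []. Qed.

Lemma wo_leNgt s t : wo_le s t = ~~ wo_lt t s.
Proof. by rewrite /wo_lt negbK. Qed.

Lemma wo_ltW s t : wo_lt s t -> wo_le s t.
Proof. by move=> st; have := wo_total s t; rewrite orbC (negbTE st). Qed.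

Lemma wo_ltxx t : wo_lt t t = false.
Proof. by rewrite /wo_lt wo_refl. Qed.

Lemma wo_le_lt_trans r s t : wo_le r s -> wo_lt s t -> wo_lt r t.
Proof. by move=> rs; apply: contra => tr; exact: wo_trans tr rs. Qed.

Lemma wo_lt_le_trans r s t : wo_lt r s -> wo_le s t -> wo_lt r t.
Proof. by move=> rs st; apply: contra rs => tr; exact: wo_trans st tr. Qed.

Lemma wo_lt_trans r s t : wo_lt r s -> wo_lt s t -> wo_lt r t.
Proof. by move=> /wo_ltW; exact: wo_le_lt_trans. Qed.

Lemma wo_le_eqVlt s t : wo_le s t -> s = t \/ wo_lt s t.
Proof.
move=> st; have [ts|nts] := boolP (wo_le t s); last by right.
by left; exact: wo_anti.
Qed.

Lemma wo_ind P : (forall t, (forall s, wo_lt s t -> P s) -> P t) ->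
  forall t, P t.
Proof.
move=> IH t; apply: contrapT => nP.
have [|r [nPr rmin]] := @wo_min (~` P); first by exists t.
apply: nPr; apply: IH => s; rewrite wo_ltNge => sr; apply: contrapT => nPs.
by move: sr; rewrite (rmin s).
Qed.

Lemma wo_lt_wf : well_founded (fun s t => is_true (wo_lt s t)).
Proof. by apply: wo_ind => t IH; constructor. Qed.

Lemma wo_coversP s t : wo_lt s t -> exists2 r, wo_covers s r & wo_le r t.
Proof.
move=> st; have [|r [sr rmin]] := @wo_min [set r | wo_lt s r];
  first by exists t.
exists r; last exact: rmin.
split=> // x xr; rewrite wo_leNgt; apply: contraL xr => sx.
by rewrite -wo_leNgt; exact: rmin.
Qed.

Lemma wo_covers_inj s s' t : wo_covers s t -> wo_covers s' t -> s = s'.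
Proof. by move=> [st sm] [s't s'm]; apply: wo_anti; [exact: s'm|exact: sm]. Qed.

Lemma wo_covers_nleast s t : wo_covers s t -> ~ wo_least t.
Proof. by move=> [/negP st _] /(_ s). Qed.

Lemma wo_lt_nleast s t : wo_lt s t -> ~ wo_least t.
Proof. by move=> /negP st /(_ s). Qed.

Lemma wo_limit_succ s t : wo_limit t -> wo_lt s t ->
  exists2 r, wo_lt s r & wo_lt r t.
Proof.
move=> [_ tlim] /[dup] st /wo_coversP[r sr rt]; exists r; first exact: sr.1.
by have [ert|//] := wo_le_eqVlt rt; subst r; case: (tlim s).
Qed.

Lemma wo_lt_limit t s0 : wo_lt s0 t ->
  (forall s, wo_lt s t -> exists2 r, wo_lt s r & wo_lt r t) -> wo_limit t.
Proof.
move=> s0t tlim; split; first exact: wo_lt_nleast s0t.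
by move=> s [/tlim[r sr rt] smax]; move: (smax r rt); rewrite wo_leNgt sr.
Qed.

Variant wo_spec t : Prop :=
| WoLeast of wo_least t
| WoSucc s of wo_covers s t
| WoLimit of wo_limit t.

Lemma woP t : wo_spec t.
Proof.
have [tl|ntl] := pselect (wo_least t); first exact: WoLeast.
have [[s st]|nc] := pselect (exists s, wo_covers s t); first exact: WoSucc st.
by apply: WoLimit; split=> // s st; apply: nc; exists s.
Qed.

End WellOrder.

Section Computation.
Variables (k : nat) (p : program k) (tapes : 'I_k.+3 -> nat -> bool).
Variable W : woType.
Implicit Types (s t : W) (c : W -> config p).

Lemma limit_config_eq c c' t : (forall s, wo_lt s t -> c s = c' s) ->
  limit_config c t = limit_config c' t.
Proof.
move=> cc'; congr Config; apply/funext => i; apply/funext => j.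
by apply/asbool_equiv_eq; split=> h s /h[r [sr rt]]; exists r; split=> //;
  [rewrite -cc'|rewrite cc'].
Qed.

Lemma computation_uniq c c' :
  is_computation tapes c -> is_computation tapes c' -> c = c'.
Proof.
move=> C C'; apply/funext; apply: wo_ind => t IH.
have [[s [st hs]]|nh] := pselect (exists s, wo_lt s t /\ halted (c s)).
  by rewrite (computation_halted C st hs) (computation_halted C' st) -?IH.
have [tl|s ts|tl] := woP t.
- by rewrite (computation_zero C) // (computation_zero C').
- by rewrite (computation_succ C ts) (computation_succ C' ts) IH //;
    exact: ts.1.
- rewrite (computation_limit C) ?(computation_limit C') //.
  + exact: limit_config_eq.
  + by move=> s st; apply/negP; rewrite -IH // => hs; apply: nh; exists s.
  + by move=> s st; apply/negP => hs; apply: nh; exists s.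
Qed.

Lemma computation_exists : exists c, is_computation tapes c.
Proof.
pose pick (A : set (config p)) :=
  if pselect (A !=set0) is left h then projT1 (cid h) else init_config p tapes.
have pickP A : A !=set0 -> A (pick A).
  by rewrite /pick; case: pselect => // h _; case: cid.
pose H c t : set (config p) :=
  [set e | exists2 s, wo_lt s t & halted (c s) /\ e = c s].
pose S c t : set (config p) :=
  [set e | exists2 s, wo_covers s t & e = step (c s)].
(* The test for an earlier halt comes first, because halting overrides the successor and limit
   rules. *)
pose next c t : config p :=
  if pselect (H c t !=set0) then pick (H c t)
  else if pselect (S c t !=set0) then pick (S c t)
  else if pselect (wo_least t) then init_config p tapes else limit_config c t.
have next_eq c c' t : (forall s, wo_lt s t -> c s = c' s) ->
    next c t = next c' t.
  move=> cc'; rewrite /next (limit_config_eq cc').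
  have -> : H c t = H c' t.
    by apply/seteqP; split=> e [s st [hs ->]]; exists s; rewrite -?cc' // cc'.
  have -> // : S c t = S c' t.
  by apply/seteqP; split=> e [s st ->]; exists s; rewrite // cc' //;
    exact: st.1.
(* Stages not below [t] receive a dummy configuration, which [next_eq] shows to be irrelevant. *)
pose F t (rec : forall s, is_true (wo_lt s t) -> config p) : config p :=
  next (fun s => match @idP (wo_lt s t) with
    ReflectT h => rec s h | _ => init_config p tapes end) t.
pose c := Fix (@wo_lt_wf W) (fun=> config p) F.
have cE t : c t = next c t.
  rewrite {1}/c Fix_eq; first last.
    move=> x f g fg; apply: next_eq => s sx; case: {-}_ / idP => // h;
      exact: fg.
  by apply: next_eq => s st; case: {-}_ / idP.
have chalt s t : wo_lt s t -> halted (c s) -> c t = c s.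
  move: t s; apply: wo_ind => t IH s st hs; rewrite cE /next.
  case: pselect => /= [/pickP[r rt [hr ->]]|[]]; last by exists (c s), s.
  have [/wo_le_eqVlt[->//|rs]|/wo_ltW/wo_le_eqVlt[->//|sr]] :=
    boolP (wo_le r s).
    by rewrite (IH s st r rs hr).
  exact: IH.
exists c; split=> //.
- move=> t tl; rewrite cE /next; case: pselect => /= [[_ [s st _]]|_].
    by case: (wo_lt_nleast st).
  case: pselect => /= [[_ [s st _]]|_]; first by case: (wo_covers_nleast st).
  by case: pselect.
- move=> s t st; have [hs|nhs] := boolP (halted (c s)).
    by rewrite (chalt _ _ st.1) // /step hs.
  rewrite cE /next; case: pselect => /= [/pickP[r rt [hr ->]]|_].
    case/negP: nhs; have [<-//|rs] := wo_le_eqVlt (st.2 _ rt).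
      by rewrite (chalt _ _ rs).
  case: pselect => /= [/pickP[r rt ->]|[]]; last by exists (step (c s)), s.
  by rewrite (wo_covers_inj st rt).
- move=> t tl nh; rewrite cE /next; case: pselect => /= [[_ [s st [hs _]]]|_].
    by move: (nh s st); rewrite hs.
  case: pselect => /= [[_ [s st _]]|_]; first by case: (tl.2 s).
  by case: pselect => // tl'; case: tl.1.
Qed.

End Computation.

(** * Runs that repeat *)

Section Loop.
Variables (k : nat) (p : program k) (tapes : 'I_k.+3 -> nat -> bool).
Variables (W V : woType) (c : W -> config p).
Hypothesis C : is_computation tapes c.
Variables (al be : W).
Hypothesis al_be : wo_lt al be.
Hypothesis be_limit : wo_limit be.
Hypothesis c_loop : c al = c be.
Hypothesis c_zero : forall t, wo_le al t -> wo_lt t be ->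
  forall i j, ctape (c t) i j -> ctape (c al) i j.

(** The least row carries the whole segment below [be]; every later row is a copy of the segment
    from [al] on. *)
Definition loop_pred (x : V * W) : bool :=
  wo_lt x.2 be && (`[< wo_least x.1 >] || wo_le al x.2).

(* The ordinal [be + (be - al) * (V - 1)]. *)
Definition loop_time := {x : V * W | loop_pred x}.

Definition loop_le (x y : loop_time) : bool :=
  wo_lt (val x).1 (val y).1 ||
  `[< (val x).1 = (val y).1 >] && wo_le (val x).2 (val y).2.

Lemma loop_le_wo : well_order loop_le.
Proof.
apply: antisymmetric_well_order => [x y|A [x Ax]].
  rewrite /loop_le => /andP[/orP[xy|/andP[/asboolP xy xy2]] /orP[yx|]].
  - by move: (wo_lt_trans xy yx); rewrite wo_ltxx.
  - by move=> /andP[/asboolP yx _]; move: xy; rewrite yx wo_ltxx.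
  - by move: yx; rewrite xy wo_ltxx.
  - move=> /andP[_ yx2]; apply: val_inj.
    by rewrite [LHS]surjective_pairing [RHS]surjective_pairing xy
      (wo_anti xy2 yx2).
have [|v [[x0 [Ax0 x0v]] vmin]] :=
    @wo_min V [set v | exists y : loop_time, y \in A /\ (val y).1 = v].
  by exists (val x).1, x.
have [|w [[y [Ay [y1 y2]]] wmin]] := @wo_min W [set w |
    exists y : loop_time, y \in A /\ (val y).1 = v /\ (val y).2 = w].
  by exists (val x0).2, x0.
exists y; split=> // z Az; rewrite /loop_le y1 y2.
have [|e|->//] := @wo_le_eqVlt _ v (val z).1; first by apply: vmin; exists z.
by rewrite asboolT // (wmin (val z).2) ?orbT //; exists z.
Qed.

Definition loop_wo : woType := WoType loop_le_wo.
Implicit Types (x y z : loop_wo).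

Definition loop_config x : config p := c (val x).2.

Lemma loop_ltP x y : wo_lt x y <->
  wo_lt (val x).1 (val y).1 \/
  (val x).1 = (val y).1 /\ wo_lt (val x).2 (val y).2.
Proof.
rewrite [wo_lt x y]/wo_lt /= /loop_le; split.
  rewrite negb_or negb_and -wo_leNgt => /andP[/wo_le_eqVlt[xy|]]; last by left.
  by rewrite xy asboolT //= => xy2; right.
case=> [xy|[xy xy2]].
  rewrite negb_or -wo_leNgt (wo_ltW xy) /=; apply/negP => /andP[/asboolP yx _].
  by move: xy; rewrite yx wo_ltxx.
by rewrite xy wo_ltxx /= negb_and -wo_ltNge xy2 orbT.
Qed.

Lemma loop_lt_be x : wo_lt (val x).2 be.
Proof. by have /andP[] := valP x. Qed.

Lemma loop_le_al v x : wo_lt v (val x).1 -> wo_le al (val x).2.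
Proof.
move=> vx; have /andP[_ /orP[/asboolP xl|//]] := valP x.
by case: (wo_lt_nleast vx).
Qed.

Lemma loop_fwd x w : wo_lt (val x).2 w -> wo_lt w be ->
  exists y, val y = ((val x).1, w).
Proof.
move=> xw wbe.
have yP : loop_pred ((val x).1, w).
  rewrite /loop_pred wbe /=; have /andP[_ /orP[->//|alx]] := valP x.
  by rewrite (wo_trans alx (wo_ltW xw)) orbT.
by exists (Sub _ yP).
Qed.

Lemma loop_halted_be w : wo_lt w be -> halted (c w) ->
  halted (c al) /\ c w = c al.
Proof.
by move=> wbe hw; rewrite c_loop (computation_halted C wbe hw).
Qed.

Lemma loop_start v : exists x, val x = (v, al).
Proof.
have xP : loop_pred (v, al) by rewrite /loop_pred al_be wo_refl orbT.
by exists (Sub _ xP).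
Qed.

(** If [x] has predecessors in its own row, they are cofinal below [x] and the limit rule of [c]
    applies. Otherwise [x] starts a later row, and the limsup over all earlier rows has to agree
    with the limsup of [c] at [be]. *)
Lemma loop_limit x : wo_limit x ->
  (forall y, wo_lt y x -> ~~ halted (loop_config y)) ->
  loop_config x = limit_config loop_config x.
Proof.
move=> xlim nh.
have [[y0 [y01 y02]]|none] := pselect (exists y : loop_wo,
    (val y).1 = (val x).1 /\ wo_lt (val y).2 (val x).2).
  have row_lt y : (val y).1 = (val x).1 -> wo_lt (val y).2 (val x).2 ->
    wo_lt y x.
    by move=> y1 y2; apply/loop_ltP; right.
  have row_ge s : wo_lt s (val x).2 -> exists y : loop_wo,
      [/\ (val y).1 = (val x).1, wo_le s (val y).2 & wo_lt (val y).2 (val x).2].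
    move=> sx; have [sy|ys] := boolP (wo_le s (val y0).2); first by exists y0.
    have [z zE] := loop_fwd ys (wo_lt_trans sx (loop_lt_be x)).
    by exists z; rewrite zE wo_refl.
  have row_cofinal y : wo_lt y x -> exists z : loop_wo,
      [/\ (val z).1 = (val x).1, wo_le y z & wo_lt (val z).2 (val x).2].
    move=> /loop_ltP[yx|[y1 y2]]; last by exists y; rewrite wo_refl.
    exists y0; split=> //; apply: wo_ltW; apply/loop_ltP; left.
    by rewrite y01.
  have row_up y z : (val y).1 = (val x).1 -> wo_le y z -> wo_lt z x ->
      [/\ (val z).1 = (val x).1, wo_le (val y).2 (val z).2 &
          wo_lt (val z).2 (val x).2].
    move=> y1 /wo_le_eqVlt[<- /loop_ltP|/loop_ltP yz /loop_ltP zx].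
      by rewrite y1 wo_ltxx => -[//|[_ ->]]; rewrite wo_refl.
    case: yz => [yz|[yz1 /wo_ltW yz2]]; case: zx => [zx|[zx1 zx2]] //.
    - by move: (wo_lt_trans yz zx); rewrite y1 wo_ltxx.
    - by move: yz; rewrite y1 zx1 wo_ltxx.
    - by move: zx; rewrite -yz1 y1 wo_ltxx.
  have x2lim : wo_limit (val x).2.
    apply: wo_lt_limit y02 _ => s /row_ge[y [y1 sy y2]].
    have [z yz zx] := wo_limit_succ xlim (row_lt _ y1 y2).
    exists (val z).2; last by have [] := row_up _ _ y1 (wo_ltW yz) zx.
    apply: wo_le_lt_trans sy _; have [z1 _ _] := row_up _ _ y1 (wo_ltW yz) zx.
    by move: yz => /loop_ltP; rewrite y1 z1 wo_ltxx => -[//|[]].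
  rewrite /loop_config (computation_limit C x2lim); last first.
    move=> s /row_ge[y [y1 sy y2]]; apply: contra (nh _ (row_lt _ y1 y2)) => hs.
    rewrite /loop_config; have [<-//|sy'] := wo_le_eqVlt sy.
    by rewrite (computation_halted C sy' hs).
  congr Config; apply/funext => i; apply/funext => j.
  apply/asbool_equiv_eq; split=> [h y /row_cofinal[z [z1 yz z2]]|h s sx].
    have [r [zr rx cr]] := h _ z2.
    have [zr'|zr'] := wo_le_eqVlt zr.
      by exists z; rewrite zr'; split=> //; exact: row_lt.
    have [u uE] := loop_fwd zr' (wo_lt_trans rx (loop_lt_be x)).
    exists u; rewrite uE; split=> //; last by apply: row_lt; rewrite uE.
    by apply: wo_trans yz _; apply: wo_ltW; apply/loop_ltP; rewrite uE; right.
  have [y [y1 sy y2]] := row_ge _ sx;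
    have [z [yz zx cz]] := h _ (row_lt _ y1 y2).
  have [_ yz2 z2] := row_up _ _ y1 yz zx.
  by exists (val z).2; split=> //; exact: wo_trans sy yz2.
have prev y : wo_lt y x -> wo_lt (val y).1 (val x).1.
  by move=> /loop_ltP[//|yx]; case: none; exists y.
have [y yx] : exists y, wo_lt y x.
  apply: contrapT => nex; apply: xlim.1 => y.
  by rewrite wo_leNgt; apply/negP => yx; apply: nex; exists y.
have x2 : (val x).2 = al.
  have [//|alx] := wo_le_eqVlt (loop_le_al (prev _ yx)).
  have [z zE] := loop_start (val x).1.
  by case: none; exists z; rewrite zE.
have [z zE] := loop_start (val y).1.
have zx : wo_lt z x by apply/loop_ltP; left; rewrite zE; exact: prev.
(* A halt below [be] would persist to [c be = c al], which is the configuration at [z], against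
   [nh]. *)
have limE : c al = limit_config c be.
  rewrite c_loop (computation_limit C) // => w wbe; apply/negP => hw.
  have [hal _] := loop_halted_be wbe hw.
  by move: (nh _ zx); rewrite /loop_config zE hal.
rewrite /loop_config x2 limE; congr Config; apply/funext => i;
  apply/funext => j.
apply/asbool_equiv_eq; split=> h.
  move=> u ux; have [r [ur rbe cr]] := h _ (loop_lt_be u).
  have [ur'|ur'] := wo_le_eqVlt ur.
    by exists u; rewrite wo_refl; split=> //; rewrite ur'.
  have [t tE] := loop_fwd ur' rbe; exists t; rewrite tE; split=> //.
    by apply: wo_ltW; apply/loop_ltP; rewrite tE; right.
  by apply/loop_ltP; left; rewrite tE; exact: prev.
(* A 1 occurring after the start [z] of an earlier row lies in a copy of the segment from [al] to
   [be], so [c_zero] puts it at [al]. *)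
suff : ctape (c al) i j by rewrite limE /= => /asboolP.
have [u [zu ux]] := h _ zx; apply: c_zero; last exact: loop_lt_be.
have [uz|/loop_ltP[|[_]]] := wo_le_eqVlt zu.
- by rewrite -uz zE wo_refl.
- exact: loop_le_al.
- by rewrite zE => /wo_ltW.
Qed.

Lemma loop_computation : is_computation tapes loop_config.
Proof.
split.
- move=> x xl; rewrite /loop_config (computation_zero C) // => w.
  rewrite wo_leNgt; apply/negP => wx.
  have yP : loop_pred ((val x).1, w).
    rewrite /loop_pred (wo_lt_trans wx (loop_lt_be x)) /=.
    apply/orP; left; apply/asboolP => v; rewrite wo_leNgt; apply/negP => vx.
    have [y yE] := loop_start v.
    by move: (xl y); rewrite wo_leNgt => /negP; apply; apply/loop_ltP;
      rewrite yE; left.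
  move: (xl (Sub _ yP)); rewrite wo_leNgt => /negP; apply; apply/loop_ltP.
  by right.
- move=> x y [xy ymax]; apply: (computation_succ C).
  (* As [be] is a limit, a row has no last point, so a covering pair lies in a single row. *)
  have [xy1|[xy1 xy2]] := (loop_ltP x y).1 xy.
    have [w xw wbe] := wo_limit_succ be_limit (loop_lt_be x).
    have [z zE] := loop_fwd xw wbe.
    have /ymax : wo_lt z y by apply/loop_ltP; rewrite zE; left.
    rewrite wo_leNgt => /negP; case; apply/loop_ltP; rewrite zE.
    by right.
  split=> // w wy; rewrite wo_leNgt; apply/negP => xw.
  have [z zE] := loop_fwd xw (wo_lt_trans wy (loop_lt_be y)).
  have /ymax : wo_lt z y by apply/loop_ltP; rewrite zE xy1; right.
  by rewrite wo_leNgt => /negP; case; apply/loop_ltP; rewrite zE; right.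
- exact: loop_limit.
- move=> x y /loop_ltP xy hx; rewrite /loop_config.
  (* A halt in one row makes [c al] halted, so all later rows are constantly [c al]. *)
  case: xy => [xy|[xy1 xy2]]; last exact: (computation_halted C xy2 hx).
  have [hal ->] := loop_halted_be (loop_lt_be x) hx.
  have [<-//|aly] := wo_le_eqVlt (loop_le_al xy).
  exact: (computation_halted C aly hal).
Qed.

End Loop.

(** With one row for each point of the order of [a], the starts of the rows embed [a], and the run
    shows [c al] at each of them. *)
Lemma loop_stage k (p : program k) (tapes : 'I_k.+3 -> nat -> bool)
    (W : woType) (c : W -> config p) (al be : W) (a : stage) :
  is_computation tapes c -> wo_lt al be -> wo_limit be -> c al = c be ->
  (forall t, wo_le al t -> wo_lt t be ->
    forall i j, ctape (c t) i j -> ctape (c al) i j) ->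
  exists b : stage, stage_le a b /\ exists c' : stage_wo b -> config p,
    is_computation tapes c' /\ c' (stage_pt b) = c al.
Proof.
move=> C al_be be_limit c_loop c_zero.
pose start (v : stage_wo a) : loop_wo (stage_wo a) al be :=
  projT1 (cid (loop_start al_be v)).
have startE v : val (start v) = (v, al) by rewrite /start; case: cid.
exists (Stage (start (stage_pt a))); split.
  by exists start; split=> [s sa|s t st _]; apply/loop_ltP; rewrite !startE;
    left.
exists (@loop_config _ _ _ _ c al be :
  stage_wo (Stage (start (stage_pt a))) -> _); split;
    first exact: loop_computation.
by rewrite /loop_config startE.
Qed.

(** * The first uncountable ordinal *)

Lemma uncountable_cantor : ~ countable [set: cantor_space].
Proof.
move=> /countable_injP[f finj].
pose d : cantor_space := fun n => `[< exists2 x : cantor_space,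
  f x = n & ~~ x n >].
have [dd|] := boolP (d (f d)).
  have /asboolP[x /finj xd] := dd.
  by rewrite xd ?inE // dd.
by move=> nd; case/negP: (nd); apply/asboolP; exists d.
Qed.

Section Omega1.

Definition wo_cantor : woType :=
  WoType (svalP (well_ordering_principle cantor_space)).

Definition ctbl_pred (t : wo_cantor) : bool :=
  `[< countable [set s | wo_lt s t] >].

(** The points with countable initial segment in a well-ordering of the continuum have order type
    $\omega_1$. *)
Definition omega1_sort := {t : wo_cantor | ctbl_pred t}.

Definition omega1_le (x y : omega1_sort) : bool := wo_le (val x) (val y).

Lemma omega1_le_wo : well_order omega1_le.
Proof.
apply: antisymmetric_well_order => [x y /andP[xy yx]|A [x Ax]].
  by apply: val_inj; exact: wo_anti.
have [|t [[y [Ay yt]] tmin]] := @wo_min wo_cantor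
    [set t | exists y : omega1_sort, y \in A /\ val y = t].
  by exists (val x), x.
exists y; split=> // z Az; rewrite /omega1_le yt.
by apply: tmin; exists z.
Qed.

Definition omega1 : woType := WoType omega1_le_wo.

Lemma omega1_seg (t : omega1) : countable [set s | wo_lt s t].
Proof.
have /asboolP/countable_injP[f finj] := valP t.
apply/countable_injP; exists (fun s => f (val s)) => x y xt yt /finj.
by move=> h; apply: val_inj; apply: h; rewrite inE; [move: xt|move: yt];
  rewrite inE.
Qed.

(** If [A] were unbounded, [omega1] would be a countable union of countable segments, hence
    countable. *)
Lemma omega1_bounded (A : set omega1) : countable A ->
  exists t, forall s, A s -> wo_lt s t.
Proof.
move=> cA; apply: contrapT => nb.
have cset : countable [set t | ctbl_pred t].
  apply: (@sub_countable _ _ _ (\bigcup_(a in A) [set t | wo_le t (val a)])).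
    apply: subset_card_le => t tP.
    have [s [As st]] : exists s, A s /\ ~~ wo_lt s (Sub t tP : omega1).
      apply: contrapT => nex; apply: nb; exists (Sub t tP) => s As.
      by apply: contrapT => /negP st; apply: nex; exists s.
    by exists s => //; move: st; rewrite -wo_leNgt.
  apply: bigcup_countable => // a _.
  apply: (@sub_countable _ _ _ ([set s | wo_lt s (val a)] `|` [set val a])).
    apply: subset_card_le => s /wo_le_eqVlt[->|]; by [right|left].
  rewrite -bigcup2E; apply: bigcup_countable => // -[|[|n]] _ //=.
  by have /asboolP := valP a.
(* If every point has a countable segment, Cantor space is countable; otherwise the least point that
   does not has its segment inside the countable set [cset]. *)
have [all|] := pselect (forall t, ctbl_pred t).
  apply: uncountable_cantor; apply: sub_countable cset.
  by apply: subset_card_le => t _; exact: all.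
move=> /existsNP[t0 nt0].
have [|t [nt tmin]] := @wo_min wo_cantor [set t | ~ ctbl_pred t];
  first by exists t0.
apply: nt; apply/asboolP; apply: sub_countable cset.
apply: subset_card_le => s st; apply: contrapT => ns.
by move: st => /=; rewrite wo_ltNge tmin.
Qed.

End Omega1.

(** * Stabilization modulo a meager set *)

Lemma countable_range (I : countType) (T : Type) (f : I -> T) :
  countable (range f).
Proof. exact: sub_countable (card_image_le _ _) (countableP _). Qed.

Section Stabilization.
Variables (I : countType) (A : omega1 -> I -> set cantor_space).
Hypothesis bA : forall t i, baire_property (A t i).

Definition limsup_at t i : set cantor_space := [set x |
  forall s, wo_lt s t -> exists r, [/\ wo_le s r, wo_lt r t & A r i x]].

Lemma baire_property_limsup_at t i : baire_property (limsup_at t i).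
Proof.
rewrite (_ : limsup_at t i = \bigcap_(s in [set s | wo_lt s t])
    \bigcup_(r in [set r | wo_lt r t /\ wo_le s r]) A r i).
  apply: baire_property_bigcap => [|s _]; first exact: omega1_seg.
  apply: baire_property_bigcup => //; apply: sub_countable (omega1_seg t).
  by apply: subset_card_le => r [].
apply/seteqP; split=> x h s /h; first by move=> [r [sr rt Ar]]; exists r.
by move=> [r [rt sr] Ar]; exists r.
Qed.

Definition killed s i t : Prop := forall r, wo_le t r -> forces s (~` A r i).

(** Being killed persists to later stages, so a bound of countably many witnesses, one for each pair
    of a string and an index, works for all. *)
Lemma killed_bound : exists t, forall s i, (exists r, killed s i r) ->
  killed s i t.
Proof.
have [t0 _] := omega1_bounded (@countable0 omega1).
have /choice[f fP] : forall si : seq bool * I, exists t,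
    (exists r, killed si.1 si.2 r) -> killed si.1 si.2 t.
  move=> si; have [[r rk]|nk] := pselect (exists r, killed si.1 si.2 r).
    by exists r.
  by exists t0.
have [|t tP] := @omega1_bounded (range f); first exact: countable_range.
exists t => s i /(fP (s, i)) k r tr; apply: k.
by apply: wo_trans tr; apply: wo_ltW; apply: tP; exists (s, i).
Qed.

(** If [s] is not killed, it fails to force the complement of some [A r i] with [r] beyond [t], so
    by the Baire property an extension forces [A r i]; [t'] bounds these countably many [r]. *)
Lemma revive t : exists2 t', wo_lt t t' & forall s i, (forall r,
  ~ killed s i r) ->
  exists r u, [/\ wo_le t r, wo_lt r t' & forces (s ++ u) (A r i)].
Proof.
have /choice[f fP] : forall si : seq bool * I, exists r,
    (forall r, ~ killed si.1 si.2 r) ->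
    wo_le t r /\ exists u, forces (si.1 ++ u) (A r si.2).
  move=> [s i] /=; have [nk|k] := pselect (forall r, ~ killed s i r);
    last first.
    by exists t => /k.
  have /existsNP[r /not_implyP[tr nf]] := nk t.
  by exists r => _; split=> //; exact: baire_property_forces.
have [|t' tP] := @omega1_bounded (t |` range f).
  rewrite -bigcup2E; apply: bigcup_countable => // -[|[|n]] _ //=.
  exact: countable_range.
exists t'; first by apply: tP; left.
move=> s i /(fP (s, i))[tr [u fu]]; exists (f (s, i)), u; split=> //.
by apply: tP; right; exists (s, i).
Qed.

Lemma omega1_iter_sup (N : omega1 -> omega1) t : (forall r, wo_lt r (N r)) ->
  exists t', [/\ wo_limit t', forall n, wo_lt (iter n N t) t' &
    forall s, wo_lt s t' -> exists n, wo_le s (iter n N t)].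
Proof.
move=> ltN; have [|u uP] := @omega1_bounded (range (fun n => iter n N t)).
  exact: countable_range.
have [|t' [t'P t'min]] := @wo_min omega1 [set v | forall n,
  wo_lt (iter n N t) v].
  by exists u => n; apply: uP; exists n.
have t'sup s : wo_lt s t' -> exists n, wo_le s (iter n N t).
  move=> st; apply: contrapT => nex; move: st; rewrite wo_ltNge t'min // => n.
  by apply/negP => sn; apply: nex; exists n.
exists t'; split=> //; apply: (@wo_lt_limit _ _ t); first exact: (t'P 0).
move=> s /t'sup[n sn]; exists (iter n.+1 N t); last exact: t'P.
exact: wo_le_lt_trans sn (ltN _).
Qed.

(* There are only countably many strings, so from some countable stage [t0] on
   each string either forces every [A r i] to fail or has, for arbitrarily large
   [r], an extension forcing [A r i]. *)
Lemma limsup_repeats : exists al be, [/\ wo_lt al be, wo_limit al, wo_limit be &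
  comeager [set x | forall i, (limsup_at al i x <-> limsup_at be i x) /\
    forall t, wo_le al t -> wo_lt t be -> A t i x -> limsup_at al i x]].
Proof.
have [t0 t0P] := killed_bound.
have /choice[N NP] : forall t, exists t', wo_lt t t' /\
    forall s i, (forall r, ~ killed s i r) ->
    exists r u, [/\ wo_le t r, wo_lt r t' & forces (s ++ u) (A r i)].
  by move=> t; have [t' tt' h] := revive t; exists t'.
have ltN r : wo_lt r (N r) by exact: (NP r).1.
(* Both [al] and [be] are limits of iterates of [N], so below each of them every string that is not
   killed is revived cofinally often. *)
have [al [al_lim al_ub al_sup]] := omega1_iter_sup t0 ltN.
have [be [be_lim be_ub be_sup]] := omega1_iter_sup al ltN.
have t0al : wo_lt t0 al by exact: (al_ub 0).
have albe : wo_lt al be by exact: (be_ub 0).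
pose K i : set cantor_space := [set x | exists2 s, killed s i t0 & cyl s x].
have KN : comeager [set x | forall i t, wo_lt t be -> wo_le t0 t -> K i x ->
  ~ A t i x].
  apply: comeager_capC => i; apply: comeager_cap => [|t _];
    first exact: omega1_seg.
  have : comeager [set x | forall s, wo_le t0 t -> killed s i t0 ->
    cyl s x -> ~ A t i x].
    apply: comeager_capC => s.
    have [[t0t sk]|nk] := pselect (wo_le t0 t /\ killed s i t0).
      by apply: comeager_sub (sk _ t0t) => x Ax _ _.
    by apply: comeager_sub comeagerT => x _ t0t sk; case: nk.
  by apply: comeager_sub => x Ax t0t [s sk]; exact: Ax.
have NK t : comeager [set x | forall i n, ~ K i x ->
    exists r, [/\ wo_le (iter n N t) r, wo_lt r (iter n.+1 N t) & A r i x]].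
  apply: comeager_capC => i; apply: comeager_capC => n.
  (* A string that is killed puts its whole cylinder into [K i]; any other one has an extension
     forcing [A r i] within the [n]-th interval. *)
  apply: comeager_dense => s; have [sk|nsk] := pselect (killed s i t0).
    exists [::]; apply: comeager_sub comeagerT => x _; rewrite cats0 => sx [].
    by exists s.
  have [|r [u [tr rt fu]]] := (NP (iter n N t)).2 s i.
    by move=> r rk; apply: nsk; apply: t0P; exists r.
  by exists u; apply: forces_sub fu => x Ax _; exists r.
exists al, be; split=> //.
apply: comeager_sub (comeagerI KN (comeagerI (NK t0) (NK al))) =>
  x [xK [x0 x1]].
(* Off a meager set, the limsups at [al] and at [be] are both the complement of [K i]. *)
have limE t t' : (forall s, wo_lt s t' -> exists n, wo_le s (iter n N t)) ->
    (forall n, wo_lt (iter n N t) t') -> wo_le t0 t -> wo_le t' be ->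
    (forall i n, ~ K i x -> exists r,
      [/\ wo_le (iter n N t) r, wo_lt r (iter n.+1 N t) & A r i x]) ->
    forall i, limsup_at t' i x <-> ~ K i x.
  move=> sup ub t0t t'be xt i; split=> [lim Ki|nK s /sup[n sn]].
    have [r [tr rt' Ar]] := lim _ (ub 0).
    exact: xK (wo_lt_le_trans rt' t'be) (wo_trans t0t tr) Ki Ar.
  have [r [nr rn Ar]] := xt i n nK; exists r; split=> //.
    exact: wo_trans sn nr.
  exact: wo_lt_trans rn (ub n.+1).
have limal := limE t0 al al_sup al_ub (wo_refl _) (wo_ltW albe) x0.
have limbe := limE al be be_sup be_ub (wo_ltW t0al) (wo_refl _) x1.
move=> i; split=> [|t alt tbe Ati]; first by rewrite limal limbe.
apply/limal => Ki; apply: xK tbe _ Ki Ati.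
exact: wo_trans (wo_ltW t0al) alt.
Qed.

End Stabilization.

(** * Baire measurability of runs *)

Section Facts.
Variables (k : nat) (p : program k).
Implicit Types (c : config p).

(** These countably many atomic facts determine a configuration ([holds_inj]), so Baire
    measurability of runs is tested on them. *)
Definition fact : countType := ('I_k.+3 * nat + 'I_(nstates p).+3 + nat)%type.

Definition holds c (a : fact) : bool :=
  match a with
  | inl (inl ij) => ctape c ij.1 ij.2
  | inl (inr q) => cstate c == q
  | inr h => chead c == h
  end.

Lemma holds_inj c c' : (forall a, holds c a <-> holds c' a) -> c = c'.
Proof.
case: c c' => [q h w] [q' h' w'] cc'.
have /= := (cc' (inl (inr q))).1 (eqxx _) => /eqP <-.
have /= := (cc' (inr h)).1 (eqxx _) => /eqP <-.
congr Config; apply/funext => i; apply/funext => j.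
by apply/idP/idP; have [] := cc' (inl (inl (i, j))).
Qed.

Section BaireConfig.
Variable c : cantor_space -> config p.
Hypothesis bc : forall a, baire_property [set x | holds (c x) a].

(** A step depends on the state, the head position and the symbols read. For each of the countably
    many such views, a fact after the step is constant or a fact before it. *)
Lemma baire_property_step a : baire_property [set x | holds (step (c x)) a].
Proof.
pose sym x : {ffun 'I_k.+3 -> bool} := [ffun i => ctape (c x) i (chead (c x))].
pose view x := (cstate (c x), chead (c x), sym x).
have -> : [set x | holds (step (c x)) a] = \bigcup_v
    ([set x | view x = v] `&` [set x | holds (step (c x)) a]).
  by apply/seteqP; split=> x; [move=> h; exists (view x)|move=> [v _ []]].
apply: baire_property_bigcup => [|[[q h] r] _]; first exact: countableP.
have bview : baire_property [set x | view x = (q, h, r)].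
  have -> : [set x | view x = (q, h,
    r)] = [set x | holds (c x) (inl (inr q))] `&`
      ([set x | holds (c x) (inr h)] `&`
      \bigcap_i [set x | holds (c x) (inl (inl (i, h))) = r i]).
    apply/seteqP; split=> x /=.
      by move=> [<- <- <-]; rewrite !eqxx; split=> //; split=> // i _ /=;
        rewrite ffunE.
    move=> [/eqP <- [/eqP hE hr]]; rewrite /view hE; congr (_, _, _).
    by apply/ffunP => i; rewrite ffunE hE; exact: hr.
  apply: baire_propertyI => //; apply: baire_propertyI => //.
  apply: baire_property_bigcap => [|i _]; first exact: countableP.
  case: (r i); first exact: bc.
  rewrite (_ : [set x | _] = ~` [set x | holds (c x) (inl (inl (i, h)))]).
    exact: baire_propertyC.
  by apply/seteqP; split=> x /=; [move=> ->|move=> /negP/negbTE].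
suff [S bS SE] : exists2 S, baire_property S & forall x, view x = (q, h, r) ->
    holds (step (c x)) a <-> S x.
  rewrite (_ : _ `&` _ = [set x | view x = (q, h, r)] `&` S).
    exact: baire_propertyI.
  by apply/seteqP; split=> x [vx]; [move=> /(SE x vx)|move=> /(SE x vx)].
have [qh|nqh] := eqVneq q (halt_state p).
  exists [set x | holds (c x) a] => // x [qE _ _].
  by rewrite /step /halted qE qh eqxx.
case dE : (delta p (q, r)) => [[q' w] dir].
have stepE x : view x = (q, h, r) -> step (c x) =
    Config q' (if dir then h.+1 else h.-1)
      (fun i j => if j == h then w i else ctape (c x) i j).
  by move=> [qE hE rE];
    rewrite /step /halted qE (negbTE nqh) -/(sym x) rE hE dE.
case: a => [[[i j]|q0]|h0].
- have [jh|jh] := eqVneq j h.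
    exists [set _ | w i]; first exact: baire_property_cst.
    by move=> x /stepE ->; rewrite /= jh eqxx.
  exists [set x | holds (c x) (inl (inl (i, j)))]; first exact: bc.
  by move=> x /stepE ->; rewrite /= (negbTE jh).
- exists [set _ | q' == q0]; first exact: baire_property_cst.
  by move=> x /stepE ->.
- exists [set _ | (if dir then h.+1 else h.-1) == h0].
    exact: baire_property_cst.
  by move=> x /stepE ->.
Qed.

End BaireConfig.

(** Facts at a limit stage, computed from the facts [L] that hold cofinally below it. The halting
    state is cofinal exactly when the run has already halted, and then [L] describes its constant
    configuration. *)
Definition limit_fact (L : fact -> Prop) (a : fact) : Prop :=
  if pselect (L (inl (inr (halt_state p)))) then L a
  else match a with
  | inl (inl ij) => L a
  | inl (inr q) => limit_state p = q
  | inr h => 0 = h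
  end.

Lemma limit_fact_eq L L' a : (forall b, L b <-> L' b) ->
  limit_fact L a <-> limit_fact L' a.
Proof.
by move=> LL'; have -> : L = L' by apply/funext => b; exact/propext.
Qed.

Lemma computation_limit_fact (tapes : 'I_k.+3 -> nat -> bool) (W : woType)
    (c : W -> config p) t a : is_computation tapes c -> wo_limit t ->
  holds (c t) a <-> limit_fact (fun b => forall s, wo_lt s t ->
    exists r, [/\ wo_le s r, wo_lt r t & holds (c r) b]) a.
Proof.
move=> C tlim; rewrite /limit_fact.
have [[s [st hs]]|nh] := pselect (exists s, wo_lt s t /\ halted (c s)).
  have LE b : (forall s, wo_lt s t ->
    exists r, [/\ wo_le s r, wo_lt r t & holds (c r) b])
      <-> holds (c t) b.
    have ct r : wo_le s r -> wo_lt r t -> c r = c t.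
      move=> /wo_le_eqVlt[<-|sr] rt; rewrite (computation_halted C st hs) //.
      by rewrite (computation_halted C sr hs).
    split=> [/(_ s st)[r [sr rt]]|hb u ut]; first by rewrite ct.
    have [us|su] := boolP (wo_le u s).
      by exists s; rewrite ct // wo_refl.
    by exists u; rewrite wo_refl ct //; exact: wo_ltW.
  case: pselect => [_|nL] /=; first by rewrite LE.
  by case: nL; apply/(LE (inl (inr (halt_state p))));
    rewrite /= (computation_halted C st hs).
have nh' s : wo_lt s t -> ~~ halted (c s).
  by move=> st; apply/negP => hs; apply: nh; exists s.
case: pselect => [L|_] /=.
  have [s st] : exists s, wo_lt s t.
    apply: contrapT => nex; apply: tlim.1 => s.
    by rewrite wo_leNgt; apply/negP => st; apply: nex; exists s.
  have [r [_ rt hr]] := L s st.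
  by case/negP: (nh' r rt); exact: hr.
rewrite (computation_limit C) //.
case: a => [[[i j]|q]|h] /=.
- by split=> /asboolP.
- by split=> /eqP.
- by split=> /eqP.
Qed.

Section Run.
Variable tapes : cantor_space -> 'I_k.+3 -> nat -> bool.
Hypothesis btapes : forall i j, baire_property [set x | tapes x i j].

Definition run x : omega1 -> config p :=
  projT1 (cid (@computation_exists k p (tapes x) omega1)).

Lemma runP x : is_computation (tapes x) (run x).
Proof. by rewrite /run; case: cid. Qed.

Lemma baire_property_run t a : baire_property [set x | holds (run x t) a].
Proof.
move: t a; apply: wo_ind => t IH a.
have [tl|s ts|tl] := woP t.
- under eq_set do rewrite (computation_zero (runP _) tl).
  case: a => [[[i j]|q]|h]; [exact: btapes| |].
    exact: (baire_property_cst (start_state p == q)).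
  exact: (baire_property_cst (0 == h)).
- under eq_set do rewrite (computation_succ (runP _) ts).
  by apply: baire_property_step => b; apply: IH; exact: ts.1.
(* The induction hypothesis covers stages below [t] only; the empty set at other stages leaves the
   limsup at [t] unchanged. *)
- pose L b :=
    limsup_at (fun r b =>
      if pselect (wo_lt r t) then [set x | holds (run x r) b] else set0) t b.
  have bL b : baire_property (L b).
    apply: baire_property_limsup_at => r d; case: pselect => rt /=.
      exact: IH.
    exact: baire_property_cst.
  have LE x : (fun b => L b x) = (fun b => forall s, wo_lt s t ->
      exists r, [/\ wo_le s r, wo_lt r t & holds (run x r) b]).
    apply/funext => b; apply/propext; split=> h s /h[r [sr rt hr]]; exists r;
      split=> //; by move: hr; case: pselect.
  have -> : [set x | holds (run x t) a] = [set x | limit_fact (fun b =>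
    L b x) a].
    by apply/seteqP; split=> x /=;
      rewrite LE => /(computation_limit_fact _ (runP x) tl).
  have -> : [set x | limit_fact (fun b => L b x) a] =
      (L (inl (inr (halt_state p))) `&` L a) `|`
      (~` L (inl (inr (halt_state p))) `&` [set x | match a with
        | inl (inl ij) => L a x
        | inl (inr q) => limit_state p = q
        | inr h => 0 = h end]).
    apply/seteqP; split=> x; rewrite /limit_fact /=.
      by case: pselect => /= hx ax; [left|right].
    by case: pselect => /= hx [[]|[]].
  apply: baire_propertyU; apply: baire_propertyI => //.
    exact: baire_propertyC.
  by case: a => [[ij|q]|h]; [exact: bL|exact: baire_property_cst..].
Qed.

(** Equal limsups of all facts give equal configurations at [al] and [be], so [loop_stage] makes the
    configuration at [al] recur beyond any stage. *)
Lemma comeager_loop : exists al, comeager [set x | forall a : stage,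
  exists b : stage, stage_le a b /\ exists c : stage_wo b -> config p,
    is_computation (tapes x) c /\ c (stage_pt b) = run x al].
Proof.
have [al [be [albe al_lim be_lim rep]]] :=
  @limsup_repeats fact (fun t a =>
    [set x | holds (run x t) a]) baire_property_run.
exists al; apply: comeager_sub rep => x rep a.
have runE t b : wo_limit t -> holds (run x t) b <-> limit_fact
    (fun d => limsup_at (fun r d => [set x | holds (run x r) d]) t d x) b.
  by move=> tlim; exact: computation_limit_fact (runP x) tlim.
apply: (loop_stage a (runP x) albe be_lim).
  apply: holds_inj => b; rewrite (runE _ b al_lim) (runE _ b be_lim);
    apply: limit_fact_eq => d.
  exact: (rep d).1.
move=> t alt tbe i j cij.
(* In both branches of [limit_fact], a cell at a limit stage shows its limsup. *)
apply/(runE al (inl (inl (i, j))) al_lim); rewrite /limit_fact.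
have lim_ij := (rep (inl (inl (i, j)))).2 t alt tbe cij.
by case: pselect.
Qed.

End Run.
End Facts.

(** * Eventually written reals and the two conclusions *)

Lemma eventual_output (z : seq cantor_space) (p : program (size z)) :
  exists h : cantor_space -> cantor_space,
    (forall m, baire_property [set x | h x m]) /\
    comeager [set x | forall y, eventually_writes p x y -> h x = y].
Proof.
have btapes (i : 'I_(size z).+3) j :
    baire_property [set x : cantor_space | initial_tapes x i j].
  rewrite /initial_tapes; case: i => -[|i] _ /=.
    exact: baire_property_coord.
  exact: baire_property_cst.
have [al loop] := comeager_loop p btapes.
exists (fun x => ctape (run p (@initial_tapes z) x al) (output_tape (size z))).
split=> [m|].
  exact: (@baire_property_run _ p _ btapes al (inl (inl (output_tape (size z),
    m)))).
apply: comeager_sub loop => x loop y [a ay].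
(* Beyond the stage [a] where the output has settled, some stage [b] shows the configuration at
   [al]; uniqueness of computations identifies the two outputs. *)
have [b [ab [c [C cb]]]] := loop a.
have [c' C' <-] := ay b ab.
by rewrite (computation_uniq C' C) cb.
Qed.

Lemma perfect_avoiding (I : countType) (h : I -> cantor_space -> cantor_space)
    (C : set cantor_space) :
  (forall i m, baire_property [set x | h i x m]) -> comeager C ->
  exists phi : cantor_space -> cantor_space,
    [/\ continuous phi, injective phi, forall u, C (phi u) &
        forall u v, u <> v -> forall i, h i (phi u) <> phi v].
Proof.
move=> bh cC.
(* The identity is put at index 0, so that avoiding it makes [phi] injective. *)
pose g n : cantor_space -> cantor_space :=
  if n is m.+1 then if unpickle m is Some i then h i else id else id.
have [|phi [phi_fin phiC phi_avoid]] := @mycielski g C _ cC.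
  move=> [|n] m; first exact: baire_property_coord.
  by rewrite /g; case: (unpickle n) => [i|];
    [exact: bh|exact: baire_property_coord].
exists phi; split=> //; first exact: finitary_continuous.
  move=> u v uv; apply: contrapT => nuv; exact: phi_avoid nuv 0 uv.
move=> u v uv i; have := phi_avoid u v uv (pickle i).+1.
by rewrite /g pickleK.
Qed.

Lemma perfect_set_of_degrees : exists P : set cantor_space,
  [/\ P !=set0, perfect_set P &
      forall x y, P x -> P y -> x <> y -> ~ ev_equiv x y].
Proof.
(* A countable type that codes all programs without parameter. *)
pose code := {n : nat & {ffun 'I_n.+3 * {ffun 'I_3 -> bool} ->
  'I_n.+3 * {ffun 'I_3 -> bool} * bool}}.
pose prog (e : code) : program 0 := Program (tagged e).
have /choice[h hP] := fun e => @eventual_output [::] (prog e).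
have [|phi [cphi iphi phiC phi_avoid]] :=
    @perfect_avoiding code h _ _ (comeager_capC (fun e => (hP e).2)).
  by move=> e; exact: (hP e).1.
exists (range phi); split.
- by exists (phi blank); exists blank.
- exact: perfect_range.
- move=> _ _ [u _ <-] [v _ <-] uv [[p pw] _].
  have pE : prog (Tagged _ (delta p)) = p by case: (p).
  apply: (phi_avoid u v _ (Tagged _ (delta p))); first by move=> e;
    rewrite e in uv.
  by apply: phiC; rewrite pE.
Qed.

(** The functions to avoid are the terms of the sequence coded by [h x]. On the range of [phi], [h]
    agrees with [f], so an equivalent [phi v] would be one of the terms at [phi u]. *)
Lemma eq_reducible_enumerable (E : cantor_space -> cantor_space -> Prop) :
  ev_enumerable E -> borel_reducible (fun x y => x = y) E.
Proof.
move=> [eqE _ [f [z [p pf]] fE]].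
have [h [bh hP]] := @eventual_output [:: z] p.
have [|phi [cphi iphi phiC phi_avoid]] :=
    @perfect_avoiding nat (fun n x => coded_seq (h x) n) _ _ hP.
  by move=> n m; exact: bh.
exists phi; first exact: continuous_borel.
move=> u v; split=> [->|Euv]; first exact: (@Equivalence_Reflexive _ _ eqE).
apply: contrapT => uv.
have : [set y | E (phi u) y] (phi v) by [].
by rewrite -fE => -[n _]; rewrite -(phiC u _ (pf _)); exact: phi_avoid.
Qed.

Theorem theorem4p7 :
  (exists P : set cantor_space,
     [/\ P !=set0, perfect_set P &
         forall x y, P x -> P y -> x <> y -> ~ ev_equiv x y]) /\
  (forall E : cantor_space -> cantor_space -> Prop,
     ev_enumerable E -> borel_reducible (fun x y => x = y) E).
Proof.
split; [exact: perfect_set_of_degrees|exact: eq_reducible_enumerable].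
Qed.
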